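(* The element $C^{(1)}=(H-1)\bar h$ is a central element of the diagonal reduction algebra $(U/J,\Diamond)$ of $\mathfrak{osp}(1|2)$.
   Context: Everything is over $\mathbb{C}$; $[\cdot,\cdot]$ is the supercommutator. The Lie superalgebra $\mathfrak{osp}(1|2)$ has even basis elements $x_{-2\alpha},h,x_{2\alpha}$ and odd basis elements $x_{-\alpha},x_\alpha$, with $[h,x_{k\alpha}]=-k\,x_{k\alpha}$ for $k\in\{\pm1,\pm2\}$, $[x_\alpha,x_\alpha]=-2x_{2\alpha}$, $[x_{-\alpha},x_{-\alpha}]=2x_{-2\alpha}$, $[x_\alpha,x_{-2\alpha}]=x_{-\alpha}$, $[x_{-\alpha},x_{2\alpha}]=x_\alpha$, $[x_\alpha,x_{-\alpha}]=h$, $[x_{-2\alpha},x_{2\alpha}]=h$, $[x_\alpha,x_{2\alpha}]=0=[x_{-\alpha},x_{-2\alpha}]$. Let $\mathfrak{G}=\mathfrak{osp}(1|2)\times\mathfrak{osp}(1|2)$. Put $X_{k\alpha}=(x_{k\alpha},x_{k\alpha})$, $H=(h,h)$, $\tilde x_{k\alpha}=(x_{k\alpha},-x_{k\alpha})$, $\tilde h=(h,-h)$. Let $\mathfrak h=\mathbb{C}H$, $\mathfrak g_\pm=\mathbb{C}X_{\pm\alpha}\oplus\mathbb{C}X_{\pm2\alpha}$. Let $D\subset U(\mathfrak h)=\mathbb{C}[H]$ be the multiplicative set generated by $\{H-n\mid n\in\mathbb{Z}\}$, $U=D^{-1}U(\mathfrak G)$ the localization, and $J=\mathfrak g_-U+U\mathfrak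 g_+$. Define rational functions by $\varphi_0(H)=1$, $\varphi_{2n-1}(H)=\frac{-1}{H-n}\varphi_{2n-2}(H)$, $\varphi_{2n}(H)=\frac1n\varphi_{2n-1}(H)$ for $n\ge1$. For $u\in U$ write $\bar u=u+J\in U/J$. The diamond product on $U/J$ is $$\bar u\Diamond\bar v=\sum_{n\ge0}u\,\varphi_n(H)X_{-\alpha}^nX_\alpha^n\,v+J$$ (all but finitely many terms lie in $J$); it is well defined and associative, and $(U/J,\Diamond)$ is (a realization of) the diagonal reduction algebra of $\mathfrak{osp}(1|2)$. Put $\bar x_{k\alpha}=\tilde x_{k\alpha}+J$, $\bar h=\tilde h+J$; elements $f(H)\in D^{-1}U(\mathfrak h)$ act on $U/J$ by $f(H)\bar u=f(H)u+J=f(H)\Diamond\bar u$. The algebra is generated by $D^{-1}U(\mathfrak h)$ and $\bar x_{\pm\alpha},\bar x_{\pm2\alpha},\bar h$. Central means commuting (without signs) with every element. *)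

(* Defs.v *)
From HB Require Import structures.
From mathcomp Require Import all_boot all_order all_algebra.
From mathcomp Require Import boolp classical_sets fsbigop reals.
From mathcomp Require Import complex.

Set Implicit Arguments.
Unset Strict Implicit.
Unset Printing Implicit Defensive.

Import GRing.Theory Num.Theory.
Local Open Scope ring_scope.
Local Open Scope quotient_scope.

Inductive word (X : Type) : Type :=
| Gen of X
| Zero | One
| Opp of word X
| Add of word X & word X
| Mul of word X & word X.

Arguments Zero {X}.
Arguments One {X}.

Section Presentation.
Variables (X : Type) (rel : word X -> word X -> Prop).

(* The smallest congruence that contains [rel] and the ring axioms. *)
Inductive cong : word X -> word X -> Prop :=
| cong_rel s t : rel s t -> cong s t
| cong_refl s : cong s s
| cong_sym s t : cong s t -> cong t s
| cong_trans t s u : cong s t -> cong t u -> cong s u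
| cong_opp s s' : cong s s' -> cong (Opp s) (Opp s')
| cong_add s s' t t' : cong s s' -> cong t t' -> cong (Add s t) (Add s' t')
| cong_mul s s' t t' : cong s s' -> cong t t' -> cong (Mul s t) (Mul s' t')
| cong_addA s t u : cong (Add s (Add t u)) (Add (Add s t) u)
| cong_addC s t : cong (Add s t) (Add t s)
| cong_add0 s : cong (Add Zero s) s
| cong_addN s : cong (Add (Opp s) s) Zero
| cong_mulA s t u : cong (Mul s (Mul t u)) (Mul (Mul s t) u)
| cong_mul1l s : cong (Mul One s) s
| cong_mul1r s : cong (Mul s One) s
| cong_mulDl s t u : cong (Mul (Add s t) u) (Add (Mul s u) (Mul t u))
| cong_mulDr s t u : cong (Mul s (Add t u)) (Add (Mul s t) (Mul s u)).

HB.instance Definition _ := gen_eqMixin (word X).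
HB.instance Definition _ := gen_choiceMixin (word X).

Definition congb (s t : word X) : bool := `[< cong s t >].

Lemma congb_equiv : equiv_class_of congb.
Proof.
split=> [s|s t|t s u].
- by apply/asboolP; exact: cong_refl.
- by apply/asboolP/asboolP; exact: cong_sym.
- by move=> /asboolP st /asboolP tu; apply/asboolP; exact: cong_trans tu.
Qed.

Canonical congb_rel := EquivRelPack congb_equiv.
Canonical congb_enc := defaultEncModRel congb.

(* A presentation may collapse to the zero ring, hence [pzRingType] below. *)
Definition pres := {eq_quot congb}.

HB.instance Definition _ := EqQuotient.on pres.
HB.instance Definition _ := Choice.on pres.

Definition cls (s : word X) : pres := \pi s.

Lemma clsP s t : cls s = cls t <-> cong s t.
Proof.
split=> [/eqP|st]; first by rewrite /cls eqmodE => /asboolP.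
by apply/eqP; rewrite /cls eqmodE; apply/asboolP.
Qed.

Lemma cls_repr (a : pres) : cls (repr a) = a.
Proof. exact: reprK. Qed.

Lemma repr_cls s : cong (repr (cls s)) s.
Proof. by apply/clsP; exact: cls_repr. Qed.

Definition pres_add (a b : pres) := cls (Add (repr a) (repr b)).
Definition pres_mul (a b : pres) := cls (Mul (repr a) (repr b)).
Definition pres_opp (a : pres) := cls (Opp (repr a)).

Lemma pres_addE s t : pres_add (cls s) (cls t) = cls (Add s t).
Proof. by apply/clsP/cong_add; exact: repr_cls. Qed.

Lemma pres_mulE s t : pres_mul (cls s) (cls t) = cls (Mul s t).
Proof. by apply/clsP/cong_mul; exact: repr_cls. Qed.

Lemma pres_oppE s : pres_opp (cls s) = cls (Opp s).
Proof. by apply/clsP/cong_opp; exact: repr_cls. Qed.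

Let presE := (pres_addE, pres_mulE, pres_oppE).

Lemma pres_addA : associative pres_add.
Proof.
move=> a b c; rewrite -[a]cls_repr -[b]cls_repr -[c]cls_repr !presE.
by apply/clsP; exact: cong_addA.
Qed.

Lemma pres_addC : commutative pres_add.
Proof. by move=> a b; apply/clsP; exact: cong_addC. Qed.

Lemma pres_add0 : left_id (cls Zero) pres_add.
Proof. by move=> a; rewrite -[a]cls_repr presE; apply/clsP; exact: cong_add0. Qed.

Lemma pres_addN : left_inverse (cls Zero) pres_opp pres_add.
Proof. by move=> a; rewrite -[a]cls_repr !presE; apply/clsP; exact: cong_addN. Qed.

HB.instance Definition _ :=
  GRing.isZmodule.Build pres pres_addA pres_addC pres_add0 pres_addN.

Lemma pres_mulA : associative pres_mul.
Proof.
move=> a b c; rewrite -[a]cls_repr -[b]cls_repr -[c]cls_repr !presE.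
by apply/clsP; exact: cong_mulA.
Qed.

Lemma pres_mul1l : left_id (cls One) pres_mul.
Proof. by move=> a; rewrite -[a]cls_repr presE; apply/clsP; exact: cong_mul1l. Qed.

Lemma pres_mul1r : right_id (cls One) pres_mul.
Proof. by move=> a; rewrite -[a]cls_repr presE; apply/clsP; exact: cong_mul1r. Qed.

Lemma pres_mulDl : left_distributive pres_mul +%R.
Proof.
move=> a b c; rewrite /GRing.add/= -[a]cls_repr -[b]cls_repr -[c]cls_repr !presE.
by apply/clsP; exact: cong_mulDl.
Qed.

Lemma pres_mulDr : right_distributive pres_mul +%R.
Proof.
move=> a b c; rewrite /GRing.add/= -[a]cls_repr -[b]cls_repr -[c]cls_repr !presE.
by apply/clsP; exact: cong_mulDr.
Qed.

HB.instance Definition _ := GRing.Zmodule_isPzRing.Build pres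
  pres_mulA pres_mul1l pres_mul1r pres_mulDl pres_mulDr.

End Presentation.

(* [hom p x] means that [x] is homogeneous of parity [p] ([true] for odd).
   The generators are the vectors of [g] together with the scalars, which are
   made into a central copy of [k]; the result is T(g) modulo the two-sided
   ideal of the  x (x) y - (-1)^(|x||y|) y (x) x - [x, y]. *)
Section Enveloping.
Variables (k : comNzRingType) (g : lmodType k).
Variables (hom : bool -> g -> Prop) (br : g -> g -> g).

Let S (a : k) : word (k + g) := Gen (inl a).
Let I (x : g) : word (k + g) := Gen (inr x).

Inductive env_rel : word (k + g) -> word (k + g) -> Prop :=
| env_scal1 : env_rel (S 1) One
| env_scalD a b : env_rel (S (a + b)) (Add (S a) (S b))
| env_scalM a b : env_rel (S (a * b)) (Mul (S a) (S b))
| env_scalC a x : env_rel (Mul (S a) (I x)) (Mul (I x) (S a))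
| env_vecD x y : env_rel (I (x + y)) (Add (I x) (I y))
| env_vecZ a x : env_rel (I (a *: x)) (Mul (S a) (I x))
| env_br p q x y : hom p x -> hom q y ->
    env_rel (Add (Mul (I x) (I y))
                 (Opp (Mul (S ((-1) ^+ (p && q))) (Mul (I y) (I x)))))
            (I (br x y)).

Definition env := pres env_rel.
HB.instance Definition _ := GRing.PzRing.on env.

Definition env_scal (a : k) : env := cls env_rel (S a).
Definition env_vec (x : g) : env := cls env_rel (I x).

End Enveloping.

Inductive mulgen (A : pzRingType) (S : A -> Prop) : A -> Prop :=
| mulgen_in a : S a -> mulgen S a
| mulgen_1 : mulgen S 1
| mulgen_M a b : mulgen S a -> mulgen S b -> mulgen S (a * b).

(* The ring obtained from [A] by freely adjoining two-sided inverses to the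
   elements of [D]; it is the ring of fractions of [A] as soon as [D] is an
   Ore set, which holds below since ad H has integer eigenvalues. *)
Section Localization.
Variables (A : pzRingType) (D : A -> Prop).

Let E (a : A) : word (A + {d : A | D d}) := Gen (inl a).
Let V (d : {d : A | D d}) : word (A + {d : A | D d}) := Gen (inr d).

Inductive loc_rel :
    word (A + {d : A | D d}) -> word (A + {d : A | D d}) -> Prop :=
| loc_emb1 : loc_rel (E 1) One
| loc_embD a b : loc_rel (E (a + b)) (Add (E a) (E b))
| loc_embM a b : loc_rel (E (a * b)) (Mul (E a) (E b))
| loc_mulV d : loc_rel (Mul (E (sval d)) (V d)) One
| loc_mulVl d : loc_rel (Mul (V d) (E (sval d))) One.

Definition loc := pres loc_rel.
HB.instance Definition _ := GRing.PzRing.on loc.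

Definition loc_emb (a : A) : loc := cls loc_rel (E a).
Definition loc_inv (d : A) (Dd : D d) : loc := cls loc_rel (V (exist _ d Dd)).

End Localization.

(* x_{-2 alpha}, x_{-alpha}, h, x_alpha, x_{2 alpha} *)
Inductive osp_idx := Xm2 | Xm1 | X0 | Xp1 | Xp2.

Definition osp_code (i : osp_idx) : 'I_5 :=
  inord (match i with Xm2 => 0 | Xm1 => 1 | X0 => 2 | Xp1 => 3 | Xp2 => 4 end).
Definition osp_decode (n : 'I_5) : osp_idx :=
  match val n with 0 => Xm2 | 1 => Xm1 | 2 => X0 | 3 => Xp1 | _ => Xp2 end%N.
Lemma osp_codeK : cancel osp_code osp_decode.
Proof. by case; rewrite /osp_decode /osp_code /= inordK. Qed.

HB.instance Definition _ := Finite.copy osp_idx (can_type osp_codeK).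

Definition osp_odd (i : osp_idx) : bool :=
  match i with Xm1 | Xp1 => true | _ => false end.

Section DiagonalReductionAlgebra.
Variable R : realType.
Local Notation C := (complex R).

Definition osp := {ffun osp_idx -> C^o}.
HB.instance Definition _ := GRing.Lmodule.on osp.

Definition osp_e (i : osp_idx) : osp := [ffun j => (j == i)%:R].

Definition osp_br_e (i j : osp_idx) : osp :=
  match i, j with
  | X0, Xm2 => 2 *: osp_e Xm2
  | X0, Xm1 => osp_e Xm1
  | X0, X0 => 0
  | X0, Xp1 => - osp_e Xp1
  | X0, Xp2 => - (2 *: osp_e Xp2)
  | Xm2, X0 => - (2 *: osp_e Xm2)
  | Xm1, X0 => - osp_e Xm1
  | Xp1, X0 => osp_e Xp1
  | Xp2, X0 => 2 *: osp_e Xp2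
  | Xp1, Xp1 => - (2 *: osp_e Xp2)
  | Xm1, Xm1 => 2 *: osp_e Xm2
  | Xp1, Xm2 => osp_e Xm1
  | Xm2, Xp1 => - osp_e Xm1
  | Xm1, Xp2 => osp_e Xp1
  | Xp2, Xm1 => - osp_e Xp1
  | Xp1, Xm1 => osp_e X0
  | Xm1, Xp1 => osp_e X0
  | Xm2, Xp2 => osp_e X0
  | Xp2, Xm2 => - osp_e X0
  | Xp1, Xp2 | Xp2, Xp1 | Xm1, Xm2 | Xm2, Xm1 | Xp2, Xp2 | Xm2, Xm2 => 0
  end.

Definition osp_br (u v : osp) : osp :=
  \sum_i \sum_j (u i * v j) *: osp_br_e i j.

Definition osp_hom (p : bool) (u : osp) : Prop :=
  forall i, osp_odd i != p -> u i = 0.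

Definition G := (osp * osp)%type.
HB.instance Definition _ := GRing.Lmodule.on G.

Definition G_br (u v : G) : G := (osp_br u.1 v.1, osp_br u.2 v.2).

Definition G_hom (p : bool) (u : G) : Prop := osp_hom p u.1 /\ osp_hom p u.2.

Definition UG := env G_hom G_br.
HB.instance Definition _ := GRing.PzRing.on UG.

Definition diag (i : osp_idx) : G := (osp_e i, osp_e i).
Definition antidiag (i : osp_idx) : G := (osp_e i, - osp_e i).

Definition H_sub (n : int) : UG := env_vec G_hom G_br (diag X0) - n%:~R.

Definition D : UG -> Prop := mulgen (fun d => exists n : int, d = H_sub n).

Definition U := loc D.
HB.instance Definition _ := GRing.PzRing.on U.

Lemma D_H_sub (n : int) : D (H_sub n).
Proof. by apply: mulgen_in; exists n. Qed.

Definition U_vec (x : G) : U := loc_emb D (env_vec G_hom G_br x).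
Definition U_scal (a : C) : U := loc_emb D (env_scal G_hom G_br a).

Definition X (i : osp_idx) : U := U_vec (diag i).
Definition tx (i : osp_idx) : U := U_vec (antidiag i).
Definition H : U := X X0.

Definition H_sub_inv (n : int) : U := loc_inv (D_H_sub n).

(* J = g_- U + U g_+, where g_- and g_+ are spanned by two elements each *)
Definition J : {pred U} := fun u => `[< exists a b c d : U,
  u = X Xm1 * a + X Xm2 * b + (c * X Xp1 + d * X Xp2) >].

Lemma J_zmod_closed : zmod_closed J.
Proof.
split; first by apply/asboolP; exists 0, 0, 0, 0; rewrite !mulr0 !mul0r !addr0.
move=> u v /asboolP[a [b [c [d ->]]]] /asboolP[a' [b' [c' [d' ->]]]].
apply/asboolP; exists (a - a'), (b - b'), (c - c'), (d - d').
rewrite !mulrBr !mulrBl opprD addrACA; congr (_ + _).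
  by rewrite opprD addrACA.
by rewrite opprD addrACA.
Qed.

HB.instance Definition _ := GRing.isZmodClosed.Build U J J_zmod_closed.

Definition DRA := Quotient.quot J.
HB.instance Definition _ := GRing.Zmodule.on DRA.
HB.instance Definition _ := EqQuotient.on DRA.

Definition bar (u : U) : DRA := \pi_DRA u.

(* phi n = phi_n(H), as an element of the image of D^-1 U(h) in U *)
Fixpoint phi (n : nat) : U :=
  if n is m.+1 then
    if odd n then - H_sub_inv (uphalf n) * phi m
    else U_scal (n./2)%:R^-1 * phi m
  else 1.

(* The product is computed on the representatives chosen by [repr], and does not
   depend on them; all but finitely many terms of the sum are 0 in U/J. *)
Definition diamond (a b : DRA) : DRA :=
  \sum_(n \in [set: nat])
    bar (repr a * phi n * X Xm1 ^+ n * X Xp1 ^+ n * repr b).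

(* f(H) acts on U/J by  f(H) . bar u = bar (f(H) u) *)
Definition C1 : DRA := bar ((H - 1) * tx X0).

End DiagonalReductionAlgebra.

(* Main.v *)
(* Let P = sum_n phi_n(H) X_-^n X_+^n be the extremal projector of the diagonal
   osp(1|2).  It satisfies X_+ P = 0 = P X_-, so the diamond product of the
   classes of u and v is the class of u P v for all representatives u and v.
   Put z = (H - 1) h~ and let Q1, Q2 be the Casimir elements of the two factors.
   Moving h~ across the powers of X_- (only X_- and X_-^2 leave a term outside
   X_- U) and cancelling H - 1 against the denominators of phi_1 = phi_2 gives
     z P = Q1 - Q2  mod X_- U,   P z = Q1 - Q2  mod U X_+.
   Since Q1 - Q2 is central in U,  z P v = (Q1 - Q2) v = v (Q1 - Q2) = v P z
   mod J.  The sums are finite because X_+ is locally ad-nilpotent on U: for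
   every v and k some X_+^N v lies in U X_+^k. *)
From HB Require Import structures.
Require Import Defs.
From mathcomp Require Import all_boot all_order all_algebra.
From mathcomp Require Import boolp classical_sets fsbigop reals.
From mathcomp Require Import complex.

Set Implicit Arguments.
Unset Strict Implicit.
Unset Printing Implicit Defensive.

Import GRing.Theory Num.Theory.
Local Open Scope ring_scope.
Local Open Scope quotient_scope.
Local Open Scope classical_set_scope.

(** * Identities in noncommutative rings *)

Inductive ncexp :=
| NcVar of nat | Nc0 | Nc1
| NcAdd of ncexp & ncexp | NcOpp of ncexp | NcMul of ncexp & ncexp
| NcMuln of ncexp & nat | NcExp of ncexp & nat.

(** Each pair is an integer coefficient with a word in the variable indices. Cancelled monomials
    stay in the list with coefficient 0, so [nc_correct] tests the coefficients and not emptiness of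
    the list. *)
Definition ncpoly := seq (int * seq nat).

Fixpoint nc_insert (c : int) (w : seq nat) (p : ncpoly) : ncpoly :=
  if p is (c', w') :: p' then
    if w == w' then (c + c', w) :: p' else (c', w') :: nc_insert c w p'
  else [:: (c, w)].

Definition nc_add (p q : ncpoly) : ncpoly := foldr (fun x => nc_insert x.1 x.2) q p.

Definition nc_scale (c : int) (w : seq nat) (p : ncpoly) : ncpoly :=
  [seq (c * x.1, w ++ x.2) | x <- p].

Definition nc_mul (p q : ncpoly) : ncpoly :=
  foldr (fun x => nc_add (nc_scale x.1 x.2 q)) [::] p.

Fixpoint nc_norm (e : ncexp) : ncpoly :=
  match e with
  | NcVar i => [:: (1, [:: i])]
  | Nc0 => [::]
  | Nc1 => [:: (1, [::])]
  | NcAdd e f => nc_add (nc_norm e) (nc_norm f)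
  | NcOpp e => nc_scale (-1) [::] (nc_norm e)
  | NcMul e f => nc_mul (nc_norm e) (nc_norm f)
  | NcMuln e n => nc_scale n%:Z [::] (nc_norm e)
  | NcExp e n => iter n (nc_mul (nc_norm e)) [:: (1, [::])]
  end.

Section NcEval.
Variables (A : pzRingType) (env : seq A).

Fixpoint nc_eval (e : ncexp) : A :=
  match e with
  | NcVar i => env`_i
  | Nc0 => 0
  | Nc1 => 1
  | NcAdd e f => nc_eval e + nc_eval f
  | NcOpp e => - nc_eval e
  | NcMul e f => nc_eval e * nc_eval f
  | NcMuln e n => nc_eval e *+ n
  | NcExp e n => nc_eval e ^+ n
  end.

Let word_eval (w : seq nat) : A := \prod_(i <- w) env`_i.

Definition ncpoly_eval (p : ncpoly) : A := \sum_(x <- p) word_eval x.2 *~ x.1.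

Lemma nc_insertE c w p :
  ncpoly_eval (nc_insert c w p) = word_eval w *~ c + ncpoly_eval p.
Proof.
rewrite /ncpoly_eval; elim: p => [|[c' w'] p IH] /=; first by rewrite big_cons.
case: eqP => [->|_]; first by rewrite !big_cons /= mulrzDr addrA.
by rewrite !big_cons /= IH addrCA.
Qed.

Lemma nc_addE p q : ncpoly_eval (nc_add p q) = ncpoly_eval p + ncpoly_eval q.
Proof.
elim: p => [|x p IH] /=; first by rewrite /ncpoly_eval big_nil add0r.
by rewrite nc_insertE IH [ncpoly_eval (_ :: _)]big_cons addrA.
Qed.

Lemma nc_scaleE c w p :
  ncpoly_eval (nc_scale c w p) = word_eval w * ncpoly_eval p *~ c.
Proof.
rewrite /ncpoly_eval big_map mulr_sumr mulrz_suml; apply: eq_bigr => x _ /=.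
by rewrite /word_eval big_cat /= mulrzAr -mulrzA [x.1 * c]mulrC.
Qed.

Lemma nc_mulE p q : ncpoly_eval (nc_mul p q) = ncpoly_eval p * ncpoly_eval q.
Proof.
elim: p => [|x p IH] /=; first by rewrite /ncpoly_eval big_nil mul0r.
by rewrite nc_addE nc_scaleE IH [ncpoly_eval (_ :: _)]big_cons mulrDl mulrzAl.
Qed.

Lemma nc_normE e : ncpoly_eval (nc_norm e) = nc_eval e.
Proof.
have one : ncpoly_eval [:: (1, [::])] = 1.
  by rewrite /ncpoly_eval big_seq1 /word_eval big_nil.
elim: e => //=.
- by move=> i; rewrite /ncpoly_eval /word_eval !big_seq1.
- by rewrite /ncpoly_eval big_nil.
- by move=> e IHe f IHf; rewrite nc_addE IHe IHf.
- by move=> e IH; rewrite nc_scaleE IH /word_eval big_nil mul1r mulrN1z.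
- by move=> e IHe f IHf; rewrite nc_mulE IHe IHf.
- by move=> e IH n; rewrite nc_scaleE IH /word_eval big_nil mul1r.
- by move=> e IH; elim=> [|n IHn] //=; rewrite nc_mulE IH IHn exprS.
Qed.

Lemma nc_correct e f :
  all (fun x => x.1 == 0) (nc_norm (NcAdd e (NcOpp f))) -> nc_eval e = nc_eval f.
Proof.
move=> z; apply/eqP; rewrite -subr_eq0.
rewrite -[_ - _]/(nc_eval (NcAdd e (NcOpp f))) -nc_normE /ncpoly_eval big_seq big1// => x xp.
by rewrite (eqP (allP z x xp)) mulr0z.
Qed.
End NcEval.

Ltac nc_index x env :=
  lazymatch env with
  | x :: _ => constr:(0%N)
  | _ :: ?env' => let i := nc_index x env' in constr:(S i)
  end.
Ltac nc_atoms t env :=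
  lazymatch t with
  | 0 => env | 1 => env
  | ?x + ?y => let env := nc_atoms x env in nc_atoms y env
  | ?x * ?y => let env := nc_atoms x env in nc_atoms y env
  | - ?x => nc_atoms x env
  | ?x *+ _ => nc_atoms x env
  | ?x ^+ _ => nc_atoms x env
  | _ => match constr:(tt) with
         | _ => let i := nc_index t env in env
         | _ => constr:(t :: env)
         end
  end.
Ltac nc_reify t env :=
  lazymatch t with
  | 0 => constr:(Nc0)
  | 1 => constr:(Nc1)
  | ?x + ?y => let e := nc_reify x env in let f := nc_reify y env in constr:(NcAdd e f)
  | ?x * ?y => let e := nc_reify x env in let f := nc_reify y env in constr:(NcMul e f)
  | - ?x => let e := nc_reify x env in constr:(NcOpp e)
  | ?x *+ ?n => let e := nc_reify x env in constr:(NcMuln e n)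
  | ?x ^+ ?n => let e := nc_reify x env in constr:(NcExp e n)
  | _ => let i := nc_index t env in constr:(NcVar i)
  end.
(* The noncommutative analogue of [ring]. *)
Ltac ncring :=
  lazymatch goal with |- @eq ?T ?x ?y =>
    let env := nc_atoms x (@nil T) in let env := nc_atoms y env in
    let e := nc_reify x env in let f := nc_reify y env in
    refine (@nc_correct _ env e f _); vm_compute; reflexivity
  end.

(** * Casimir elements of osp(1|2) and of two supercommuting copies *)

(* In the applications [c] is a sum of terms u * (l - r) * v over known relations
   l = r, and [x - y = c] is left to [ncring]. *)
Lemma eq_modulo (A : pzRingType) (x y c : A) : x - y = c -> c = 0 -> x = y.
Proof. by move=> e c0; apply/eqP; rewrite -subr_eq0 e c0. Qed.

Lemma comm_inverse (A : pzRingType) (c x w : A) : w * x = 1 -> x * w = 1 ->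
  GRing.comm c x -> GRing.comm c w.
Proof.
move=> wx xw cx; rewrite /GRing.comm.
by rewrite -[LHS]mul1r -wx -mulrA (mulrA x) -cx -mulrA xw mulr1.
Qed.

(* A copy of osp(1|2) given by a = x_alpha, b = x_(-alpha) and h, from which
   x_(2 alpha) = - a^2 and x_(-2 alpha) = b^2 are recovered. *)
Record osp_triple (A : pzRingType) (a b h : A) : Prop := OspTriple {
  osp_anticomm : a * b + b * a = h;
  osp_hb : h * b = b * h + b;
  osp_ah : a * h = h * a + a }.

(* The anti-automorphism exchanging the two odd root vectors transfers every
   statement to its mirror image. *)
Lemma osp_triple_conv (A : pzRingType) (a b h : A) :
  osp_triple a b h -> @osp_triple A^c b a h.
Proof. by case=> ab hb ah; split. Qed.

Lemma osp_ab (A : pzRingType) (a b h : A) (t : osp_triple a b h) : a * b = h - b * a.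
Proof. by rewrite -(osp_anticomm t) addrK. Qed.

Lemma osp_h_bX (A : pzRingType) (a b h : A) (t : osp_triple a b h) n :
  h * b ^+ n = b ^+ n * (h + n%:R).
Proof.
elim: n => [|n IH]; first by rewrite mulr1 mul1r addr0.
rewrite exprSr mulrA IH -!mulrA; congr (_ * _).
by rewrite mulrDl (osp_hb t) mulrDr mulr_natl mulr_natr mulrS addrA.
Qed.

Section Triple.
Variables (A : pzRingType) (a b h : A).
Hypothesis t : osp_triple a b h.

Lemma osp_bX_h n : b ^+ n * h = (h - n%:R) * b ^+ n.
Proof. by rewrite mulrBl (osp_h_bX t) mulrDr mulr_natl mulr_natr addrK. Qed.

(** Each [b] that [a] crosses costs a sign and a term in [h], so the closed formula depends on the
    parity of the exponent; the two cases are proved alternately, one more factor [b] at a time. At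
    [m = 0] the truncated exponent [m.*2.-1] is harmless, its multiplicity being 0. *)
Lemma osp_a_bX m :
  a * b ^+ m.*2 = b ^+ m.*2 * a + b ^+ m.*2.-1 *+ m
  /\ a * b ^+ m.*2.+1 = (h - m%:R) * b ^+ m.*2 - b ^+ m.*2.+1 * a.
Proof.
have hab := osp_ab t.
have odd_step n : a * b ^+ n.*2 = b ^+ n.*2 * a + b ^+ n.*2.-1 *+ n ->
    a * b ^+ n.*2.+1 = (h - n%:R) * b ^+ n.*2 - b ^+ n.*2.+1 * a.
  move=> e; rewrite {1}exprSr mulrA e mulrDl -mulrA hab mulrBr (mulrA _ b a) -exprSr.
  have -> : b ^+ n.*2.-1 *+ n * b = b ^+ n.*2 *+ n.
    by case: n {e} => [|n]; rewrite ?mulr0n ?mul0r// mulrnAl -exprSr.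
  rewrite osp_bX_h -(mulr_natl (b ^+ _)) addrAC -mulrDl -addrA; congr (_ * _ - _).
  by rewrite -addnn natrD opprD !addrA addrNK.
have even m' : a * b ^+ m'.*2 = b ^+ m'.*2 * a + b ^+ m'.*2.-1 *+ m'.
  elim: m' => [|n IH]; first by rewrite mulr1 mul1r addr0.
  rewrite doubleS [in LHS]exprSr mulrA (odd_step _ IH) [LHS]mulrBl.
  rewrite -[X in X - _]mulrA -[X in _ - X]mulrA hab -exprSr mulrBr.
  (* The coefficient of b^(2n+1) becomes (h - n) - (h - (2n+1)) = n + 1. *)
  rewrite osp_bX_h /= mulrA -exprSr opprB addrCA -mulrBl; congr (_ + _).
  rewrite -[RHS]mulr_natl; congr (_ * _).
  by rewrite opprB addrC addrA subrK -addnn -addnS natrD addrAC subrr add0r.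
by split; [exact: even | exact/odd_step/even].
Qed.

Lemma osp_aX_h n : a ^+ n * h = (h + n%:R) * a ^+ n.
Proof. by have := osp_h_bX (osp_triple_conv t) n; rewrite revrX. Qed.
End Triple.

(* In terms of the root vectors,
   h^2 - h - 2 x_(-alpha) x_alpha + 4 x_(-2 alpha) x_(2 alpha). *)
Definition casimir (A : pzRingType) (a b h : A) : A :=
  h ^+ 2 - h - (b * a) *+ 2 - (b ^+ 2 * a ^+ 2) *+ 4.

Lemma casimir_comm_a (A : pzRingType) (a b h : A) : osp_triple a b h ->
  GRing.comm a (casimir a b h).
Proof.
case=> r1 r2 r3; rewrite /GRing.comm /casimir.
pose ab := a * b + b * a - h; pose hb := h * b - b * h - b; pose ah := a * h - h * a - a.
(* The commutator of [a] with the Casimir element, written as a two-sided combination of the defects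
   of the three relations. *)
apply: (@eq_modulo _ _ _ (ah * h + h * ah - (ab * a) *+ 2
   - ((ab * b - b * ab + hb) * a ^+ 2) *+ 4)).
  by rewrite /ab /hb /ah; ncring.
have -> : ab = 0 by rewrite /ab r1 subrr.
have -> : hb = 0 by rewrite /hb r2; ncring.
have -> : ah = 0 by rewrite /ah r3; ncring.
by ncring.
Qed.

(** The anti-automorphism exchanging [a] and [b] fixes the Casimir element. *)
Lemma casimir_comm_b (A : pzRingType) (a b h : A) : osp_triple a b h ->
  GRing.comm b (casimir a b h).
Proof. by move=> t; apply/esym; exact: (casimir_comm_a (osp_triple_conv t)). Qed.

(** * Two supercommuting copies of osp(1|2), their diagonal and antidiagonal elements *)

Lemma comm_of_anticomm (A : pzRingType) (x y z : A) :
  x * z + z * x = 0 -> y * z + z * y = 0 -> GRing.comm z (x * y).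
Proof.
move=> xz yz; apply: (@eq_modulo _ _ _ ((x * z + z * x) * y - x * (y * z + z * y))).
  by ncring.
by rewrite xz yz; ncring.
Qed.

(** Only odd generators are required to anticommute: [h] and [h'] are anticommutators of odd
    generators, so the commutation rules involving them follow. *)
Record osp_pair (A : pzRingType) (a b h a' b' h' : A) : Prop := OspPair {
  osp_pair_l : osp_triple a b h;
  osp_pair_r : osp_triple a' b' h';
  osp_pair_aa : a * a' + a' * a = 0;
  osp_pair_ab : a * b' + b' * a = 0;
  osp_pair_ba : b * a' + a' * b = 0;
  osp_pair_bb : b * b' + b' * b = 0 }.

Lemma osp_pair_conv (A : pzRingType) (a b h a' b' h' : A) :
  osp_pair a b h a' b' h' -> @osp_pair A^c b a h b' a' h'.
Proof.
by case=> t t' aa ab ba bb; split; rewrite 1?[LHS]addrC//; exact: osp_triple_conv.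
Qed.

Lemma osp_pair_swap (A : pzRingType) (a b h a' b' h' : A) :
  osp_pair a b h a' b' h' -> osp_pair a' b' h' a b h.
Proof. by case=> t t' aa ab ba bb; split; rewrite 1?[LHS]addrC. Qed.

Lemma osp_pair_comm_h (A : pzRingType) (a b h a' b' h' : A) : osp_pair a b h a' b' h' ->
  [/\ GRing.comm a' h, GRing.comm b' h & GRing.comm h' h].
Proof.
case=> [[<- _ _] [<- _ _] aa ab ba bb].
have ca : GRing.comm a' (a * b + b * a) by apply: commrD; exact: comm_of_anticomm.
have cb : GRing.comm b' (a * b + b * a) by apply: commrD; exact: comm_of_anticomm.
by split=> //; apply/commr_sym/commrD; apply/commrM; exact: commr_sym.
Qed.

Section Pair.
Variables (A : pzRingType) (a b h a' b' h' : A).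
Hypothesis P : osp_pair a b h a' b' h'.

Lemma casimir_comm_pair : GRing.comm a' (casimir a b h) /\ GRing.comm b' (casimir a b h).
Proof.
have [ca cb _] := osp_pair_comm_h P.
case: P => [_ _ aa ab ba bb]; rewrite /casimir !expr2.
by split; repeat first [exact: comm_of_anticomm | assumption
  | apply: commrB | apply: commrMn | apply: commrM].
Qed.

Lemma osp_pair_add : osp_triple (a + a') (b + b') (h + h').
Proof.
have [ca' cb' _] := osp_pair_comm_h P; have [ca cb _] := osp_pair_comm_h (osp_pair_swap P).
case: P => [[ab hb ah] [ab' hb' ah'] _ xab xba _].
split.
- rewrite -ab -ab'; apply: (@eq_modulo _ _ _ ((a * b' + b' * a) + (b * a' + a' * b))).
    by ncring.
  by rewrite xab xba addr0.
- by rewrite mulrDl !mulrDr hb hb' -cb' -cb; ncring.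
- by rewrite mulrDl !mulrDr ah ah' ca' ca; ncring.
Qed.

Lemma osp_pair_diff_b : (h - h') * (b + b') = (b + b') * (h - h') + (b - b').
Proof.
have [_ cb' _] := osp_pair_comm_h P; have [_ cb _] := osp_pair_comm_h (osp_pair_swap P).
case: P => [[_ hb _] [_ hb' _] _ _ _ _].
by rewrite mulrBl !mulrDr hb hb' -cb' -cb; ncring.
Qed.

Lemma osp_pair_diff_bb :
  (h - h') * (b + b') ^+ 2 = (b + b') ^+ 2 * (h - h') + (b ^+ 2 - b' ^+ 2) *+ 2.
Proof.
by rewrite expr2 mulrA osp_pair_diff_b mulrDl -mulrA osp_pair_diff_b; ncring.
Qed.

(** Since b^2 and b'^2 commute with b + b', the term left over by the square slides behind the third
    factor. So h~ times the cube, or any higher power, of X_- lies in X_- U. *)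
Lemma osp_pair_diff_bbb :
  (h - h') * (b + b') ^+ 3 =
  (b + b') * ((b + b') ^+ 2 * (h - h') + (b ^+ 2 - b' ^+ 2) *+ 2 + (b + b') * (b - b')).
Proof.
rewrite exprSr mulrA osp_pair_diff_bb mulrDl -mulrA osp_pair_diff_b.
case: P => _ _ _ _ _ bb.
apply: (@eq_modulo _ _ _ ((b - b') * (b * b' + b' * b) *+ 2
  - (b * b' + b' * b) * (b - b') *+ 2)).
  by ncring.
by rewrite bb; ncring.
Qed.
End Pair.

Section PairRight.
Variables (A : pzRingType) (a b h a' b' h' : A).
Hypothesis P : osp_pair a b h a' b' h'.

Lemma osp_pair_diff_a : (a + a') * (h - h') = (h - h') * (a + a') + (a - a').
Proof. exact: (osp_pair_diff_b (osp_pair_conv P)). Qed.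

Lemma osp_pair_diff_aa :
  (a + a') ^+ 2 * (h - h') = (h - h') * (a + a') ^+ 2 + (a ^+ 2 - a' ^+ 2) *+ 2.
Proof. exact: (osp_pair_diff_bb (osp_pair_conv P)). Qed.

Lemma osp_pair_diff_aaa :
  (a + a') ^+ 3 * (h - h') =
  ((h - h') * (a + a') ^+ 2 + (a ^+ 2 - a' ^+ 2) *+ 2 + (a - a') * (a + a')) * (a + a').
Proof.
have := osp_pair_diff_bbb (osp_pair_conv P).
by rewrite ![in X in X -> _]revrX.
Qed.

(** The left side is what survives of z P modulo left multiples of b + b', once h~ has crossed the
    powers of b + b' and H - 1 has cancelled. The mirror identity [osp_pair_casimir_a] serves P
    z. *)
Lemma osp_pair_casimir_b :
  (h + h' - 1) * (h - h') - (b - b') * (a + a')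
    - (b ^+ 2 - b' ^+ 2) * (a + a') ^+ 2 *+ 2
  = casimir a b h - casimir a' b' h'
    + (b + b') * ((a - a') + (b + b') * (a ^+ 2 - a' ^+ 2) *+ 2).
Proof.
have [_ _ ch] := osp_pair_comm_h P; case: P => _ _ aa _ _ bb.
apply: (@eq_modulo _ _ _ (h' * h - h * h' - (b ^+ 2 - b' ^+ 2) * (a * a' + a' * a) *+ 2
   - (b * b' + b' * b) * (a ^+ 2 - a' ^+ 2) *+ 2)).
  by rewrite /casimir; ncring.
by rewrite ch aa bb; ncring.
Qed.

Lemma osp_pair_casimir_a :
  (h + h' - 1) * (h - h') - (b + b') * (a - a')
    - (b + b') ^+ 2 * (a ^+ 2 - a' ^+ 2) *+ 2
  = casimir a b h - casimir a' b' h'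
    + ((b - b') + (b ^+ 2 - b' ^+ 2) * (a + a') *+ 2) * (a + a').
Proof.
have [_ _ ch] := osp_pair_comm_h P; case: P => _ _ aa _ _ bb.
apply: (@eq_modulo _ _ _ (h' * h - h * h' - (b ^+ 2 - b' ^+ 2) * (a * a' + a' * a) *+ 2
   - (b * b' + b' * b) * (a ^+ 2 - a' ^+ 2) *+ 2)).
  by rewrite /casimir; ncring.
by rewrite ch aa bb; ncring.
Qed.
End PairRight.

(** * The extremal projector *)

Lemma osp_aX_b (A : pzRingType) (a b h : A) (t : osp_triple a b h) m :
  a ^+ m.*2 * b = b * a ^+ m.*2 + a ^+ m.*2.-1 *+ m
  /\ a ^+ m.*2.+1 * b = (h + m%:R) * a ^+ m.*2 - b * a ^+ m.*2.+1.
Proof.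
have [] := osp_a_bX (osp_triple_conv t) m; rewrite !revrX => e o; split=> //.
apply: etrans o _; congr (_ - _).
(* Moving [h] left across a^(2m) adds 2m, which turns h - m into h + m. *)
transitivity (a ^+ m.*2 * (h - m%:R)); first by [].
rewrite mulrBr (osp_aX_h t) mulr_natr -(mulr_natl (a ^+ _)) -mulrBl -addnn natrD addrA addrK.
by [].
Qed.

Lemma osp_aa_b (A : pzRingType) (a b h : A) : osp_triple a b h -> a ^+ 2 * b = b * a ^+ 2 + a.
Proof. by move=> t; exact: (osp_aX_b t 1).1. Qed.

(** The square of X_+ is even, so it acts by a plain commutator: it sends [b] to [a] and kills [a].
    This is the source of local nilpotency. *)
Lemma osp_pair_sqr_b (A : pzRingType) (a b h a' b' h' : A) : osp_pair a b h a' b' h' ->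
  (a + a') ^+ 2 * b = b * (a + a') ^+ 2 + a.
Proof.
case=> t _ aa _ ba _.
apply: (@eq_modulo _ _ _ ((a ^+ 2 * b - b * a ^+ 2 - a)
  + (a' * (b * a' + a' * b) - (b * a' + a' * b) * a')
  + ((a * a' + a' * a) * b - b * (a * a' + a' * a)))); first by ncring.
by rewrite (osp_aa_b t) aa ba; ncring.
Qed.

Lemma osp_pair_sqr_a (A : pzRingType) (a b h a' b' h' : A) : osp_pair a b h a' b' h' ->
  (a + a') ^+ 2 * a = a * (a + a') ^+ 2.
Proof.
case=> _ _ aa _ _ _.
apply: (@eq_modulo _ _ _ ((a * a' + a' * a) * a - a * (a * a' + a' * a)
  + a' * (a * a' + a' * a) - (a * a' + a' * a) * a')); first by ncring.
by rewrite aa; ncring.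
Qed.

(* The coefficients of the projector, abstractly: f n = phi_n(H) and
   g n = phi_n(H + 1). *)
Record proj_coefs (A : pzRingType) (a b h : A) (f g : nat -> A) : Prop := ProjCoefs {
  pc_f0 : f 0%N = 1;
  pc_f_odd k : f k.*2.+1 * (h - k.+1%:R) = - f k.*2;
  pc_f_even k : f k.+1.*2 *+ k.+1 = f k.*2.+1;
  pc_g_odd k : g k.*2.+1 * (h - k%:R) = - g k.*2;
  pc_g_even k : g k.+1.*2 *+ k.+1 = g k.*2.+1;
  pc_af n : a * f n = g n * a;
  pc_fb n : f n * b = b * g n }.

(** A truncation of the extremal projector, whose full series is infinite; for fixed arguments of
    the diamond product all later terms fall into J. *)
Definition proj (A : pzRingType) (a b : A) (f : nat -> A) (N : nat) : A :=
  \sum_(n < N) f n * b ^+ n * a ^+ n.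

Lemma projS (A : pzRingType) (a b : A) (f : nat -> A) (N : nat) :
  proj a b f N.+1 = proj a b f N + f N * b ^+ N * a ^+ N.
Proof. exact: big_ord_recr. Qed.

Lemma nat_parity_ind (P : nat -> Prop) :
  P 0%N -> (forall k, P k.*2 -> P k.*2.+1) -> (forall k, P k.*2.+1 -> P k.+1.*2) ->
  forall n, P n.
Proof.
move=> P0 Pe Po n.
have H : forall k, P k.*2 by elim=> // k IH; apply/Po/Pe.
by rewrite -[n]odd_double_half; case: odd; [exact/Pe/H | exact: H].
Qed.

Section Projector.
Variables (A : pzRingType) (a b h : A) (f g : nat -> A).
Hypotheses (t : osp_triple a b h) (fg : proj_coefs a b h f g).
Local Notation P := (proj a b f).

(** The truncated form of P X_- = 0: by the recursions for [f], each new term cancels the previous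
    remainder, and only a top term remains. Its high power of [a] later carries it into J. *)
Lemma proj_mulb N : P N.+1 * b = (-1) ^+ N * f N * b ^+ N.+1 * a ^+ N.
Proof.
elim/nat_parity_ind: N => [|k IH|k IH]; rewrite projS.
- by rewrite /proj big_ord0 add0r (pc_f0 fg) !expr0 !mul1r !mulr1.
- rewrite mulrDl IH -!(mulrA (f _ * _)) (osp_aX_b t k).2.
  have -> : (-1) ^+ k.*2.+1 = -1 :> A by rewrite -signr_odd /= odd_double.
  have -> : (-1) ^+ k.*2 = 1 :> A by rewrite -signr_odd odd_double.
  (* The factor h - (k+1) is exactly the denominator of f_(2k+1). *)
  have shift : b ^+ k.*2.+1 * (h + k%:R) = (h - k.+1%:R) * b ^+ k.*2.+1.
    rewrite mulrDr (osp_bX_h t) mulr_natr -(mulr_natl (b ^+ _)) -mulrDl.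
    by rewrite -addnn -addnS addnC natrD opprD addrA addrNK.
  rewrite (exprSr b k.*2.+1) mulrBr -!mulrA [b ^+ _ * (_ * _)]mulrA shift !mulrA (pc_f_odd fg).
  by rewrite !mul1r !mulNr mul1r addrA subrr add0r.
- rewrite mulrDl IH -!(mulrA (f _ * _)) (osp_aX_b t k.+1).1.
  have -> : (-1) ^+ k.*2.+1 = -1 :> A by rewrite -signr_odd /= odd_double.
  have -> : (-1) ^+ k.+1.*2 = 1 :> A by rewrite -signr_odd odd_double.
  rewrite mulrDr !mulrnAr /= -!mulrnAl (pc_f_even fg) mulN1r mul1r !mulNr addrCA addNr addr0.
  rewrite (exprSr b k.+1.*2).
  by move: (b ^+ k.+1.*2) (a ^+ k.+1.*2) (f k.+1.*2) => B C F; rewrite !mulrA.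
Qed.

(** The truncated form of X_+ P = 0. Here [a] first crosses the coefficients and turns [f] into [g],
    whose denominators h - k match those produced by [osp_a_bX]. *)
Lemma mula_proj N : a * P N.+1 = (-1) ^+ N * g N * b ^+ N * a ^+ N.+1.
Proof.
elim/nat_parity_ind: N => [|k IH|k IH]; rewrite projS.
- by rewrite /proj big_ord0 add0r !expr0 !mulr1 (pc_af fg) mul1r expr1.
- have -> : (-1) ^+ k.*2.+1 = -1 :> A by rewrite -signr_odd /= odd_double.
  have e1 : (-1) ^+ k.*2 = 1 :> A by rewrite -signr_odd odd_double.
  rewrite mulrDr IH e1 -!(mulrA (f _)) (mulrA a) (pc_af fg).
  rewrite -(mulrA (g _) a) (mulrA a) (osp_a_bX t k).2 (exprS a k.*2.+1).
  move: (b ^+ k.*2.+1) (b ^+ k.*2) (a ^+ k.*2.+1) (pc_g_odd fg k) => B C D e.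
  apply: (@eq_modulo _ _ _ ((g k.*2.+1 * (h - k%:R) + g k.*2) * C * D)).
    by move: (k%:R) (g _) (g _) => K G G'; ncring.
  by rewrite e addNr !mul0r.
- have e1 : (-1) ^+ k.*2.+1 = -1 :> A by rewrite -signr_odd /= odd_double.
  have -> : (-1) ^+ k.+1.*2 = 1 :> A by rewrite -signr_odd odd_double.
  rewrite mulrDr IH e1 -!(mulrA (f _)) (mulrA a) (pc_af fg).
  rewrite -(mulrA (g _) a) (mulrA a) (osp_a_bX t k.+1).1 -(pc_g_even fg k) (exprS a k.+1.*2) /=.
  move: (b ^+ k.*2.+1) (b ^+ k.+1.*2) (a ^+ k.+1.*2) (g k.+1.*2) => B C D G.
  rewrite -(mulr_natl B) -(mulr_natr G); move: (k.+1%:R) => K; ncring.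
Qed.
End Projector.

(** * Products of the candidate central element with the projector *)

Section Central.
Variables (A : pzRingType) (a b h a' b' h' : A) (f g : nat -> A).
Hypotheses (P : osp_pair a b h a' b' h').
Hypothesis fg : proj_coefs (a + a') (b + b') (h + h') f g.
Hypothesis f_comm : forall n, GRing.comm (f n) (h - h').
Hypothesis f_commh : forall n, GRing.comm (f n) (h + h').
Local Notation p := (a + a').
Local Notation m := (b + b').
Local Notation k := (h + h').
Local Notation t := (h - h').
Local Notation z := ((k - 1) * t).
Local Notation om := (casimir a b h - casimir a' b' h').
Local Notation pr := (proj p m f).

Lemma proj_coefs2 : f 2 = f 1.
Proof. exact: (pc_f_even fg 0). Qed.

Lemma proj_coefs1 : f 1 * (k - 1) = - 1.
Proof. by rewrite (pc_f_odd fg 0) (pc_f0 fg). Qed.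

Lemma central_proj_tail n : exists w, z * f n.+3 * m ^+ n.+3 = m * w.
Proof.
have th := osp_pair_add P.
have [w e] : exists w, t * m ^+ n.+3 = m * w.
  by rewrite -addn3 addnC exprD mulrA (osp_pair_diff_bbb P) -mulrA; eexists.
(* The factor [k - 1] of [z] becomes [k + 1 - 1], and [f] becomes [g], on crossing the leading
   [m]. *)
exists ((k + 1 - 1) * (g n.+3 * w)).
rewrite -!mulrA [t * (_ * _)]mulrA -f_comm -(mulrA _ t) e.
rewrite [f _ * _]mulrA (pc_fb fg) -!mulrA mulrA mulrBl (osp_hb th) mul1r.
by rewrite -addrA subrr addr0 -mulrA addrK.
Qed.

Lemma proj_central_tail n : exists w, p ^+ n.+3 * z = w * p.
Proof.
have th := osp_pair_add P.
have [w e] : exists w, p ^+ n.+3 * t = w * p.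
  by rewrite -addn3 exprD -mulrA (osp_pair_diff_aaa P) mulrA; eexists.
exists ((k + n.+3%:R - 1) * w).
have -> : p ^+ n.+3 * z = (k + n.+3%:R - 1) * (p ^+ n.+3 * t).
  by rewrite [RHS]mulrA [_ * p ^+ _]mulrBl -(osp_aX_h th); move: (p ^+ _) => q; ncring.
by rewrite e mulrA.
Qed.

Lemma projD3 N : pr (3 + N) =
  1 + f 1 * m * p + f 1 * m ^+ 2 * p ^+ 2 + \sum_(n < N) f n.+3 * m ^+ n.+3 * p ^+ n.+3.
Proof.
rewrite /proj !big_ord_recl /= (pc_f0 fg) !expr0 !mulr1 !addrA; congr (_ + _ + _ + _).
by rewrite proj_coefs2.
Qed.

Lemma central_proj N : exists w, z * pr (3 + N) = om + m * w.
Proof.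
(* The factor H - 1 of the central element is there to cancel the denominator of phi_1 = phi_2. *)
have zf : z * f 1 = - t.
  rewrite -mulrA -f_comm mulrA mulrBl mul1r -f_commh.
  by rewrite -[X in _ - X]mulr1 -mulrBr proj_coefs1 mulN1r.
have [w e] : exists w, \sum_(n < N) z * (f n.+3 * m ^+ n.+3 * p ^+ n.+3) = m * w.
  elim: N => [|N [w IH]]; first by exists 0; rewrite big_ord0 mulr0.
  rewrite big_ord_recr /= IH (mulrA z (_ * _)) (mulrA z).
  have [w' ->] := central_proj_tail N.
  by exists (w + w' * p ^+ N.+3); rewrite mulrDr (mulrA m w').
rewrite projD3 -!(mulrA (f 1)) !(mulrDr z) mulr1 mulr_sumr e !(mulrA z) zf.
rewrite !mulNr (mulrA t m) (mulrA t (m ^+ 2)) (osp_pair_diff_b P) (osp_pair_diff_bb P).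
(* The first two terms come from [osp_pair_casimir_b], the next two from the parts of t m p and t
   m^2 p^2 that start with [m], and [w] from the tail. *)
exists ((a - a') + m * (a ^+ 2 - a' ^+ 2) *+ 2 - t * p - m * t * p ^+ 2 + w).
have := osp_pair_casimir_b P; move: om => o /eqP; rewrite -subr_eq => /eqP <-.
by ncring.
Qed.

Lemma proj_central N : exists w, pr (3 + N) * z = om + w * p.
Proof.
have th := osp_pair_add P.
(* As m p has weight 0, [k - 1] crosses it unchanged and cancels against [f 1]; only [t] remains to
   be moved across [p]. The same holds for m^2 p^2 below. *)
have z1 : f 1 * m * p * z = - (m * (t * p + (a - a'))).
  rewrite -(osp_pair_diff_a P).
  apply: (@eq_modulo _ _ _ (f 1 * m * (p * k - k * p - p) * t
    - f 1 * (k * m - m * k - m) * p * t + (f 1 * (k - 1) + 1) * m * p * t)).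
    by ncring.
  rewrite (osp_ah th) (osp_hb th) proj_coefs1; ncring.
have z2 : f 1 * m ^+ 2 * p ^+ 2 * z = - (m ^+ 2 * (t * p ^+ 2 + (a ^+ 2 - a' ^+ 2) *+ 2)).
  rewrite -(osp_pair_diff_aa P).
  apply: (@eq_modulo _ _ _ (f 1 * m ^+ 2 * (p ^+ 2 * k - (k + 2%:R) * p ^+ 2) * t
    + f 1 * (m ^+ 2 * k - (k - 2%:R) * m ^+ 2) * p ^+ 2 * t
    + (f 1 * (k - 1) + 1) * m ^+ 2 * p ^+ 2 * t)).
    by ncring.
  rewrite (osp_aX_h th) (osp_bX_h th) proj_coefs1; ncring.
have [w e] : exists w, \sum_(n < N) (f n.+3 * m ^+ n.+3 * p ^+ n.+3) * z = w * p.
  elim: N => [|N [w IH]]; first by exists 0; rewrite big_ord0 mul0r.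
  rewrite big_ord_recr /= IH -(mulrA _ _ z).
  have [w' ->] := proj_central_tail N.
  by exists (w + f N.+3 * m ^+ N.+3 * w'); rewrite mulrDl (mulrA _ w').
have expand (u v s : A) : (1 + u + v + s) * z = z + u * z + v * z + s * z by ncring.
rewrite projD3 expand mulr_suml e z1 z2.
exists ((b - b') + (b ^+ 2 - b' ^+ 2) * p *+ 2 - m * t - m ^+ 2 * t * p + w).
have := osp_pair_casimir_a P; move: om => o /eqP; rewrite -subr_eq => /eqP <-.
by ncring.
Qed.
End Central.

(** * The localized enveloping algebra *)

Section Pres.
Variables (X : Type) (rel : word X -> word X -> Prop).
Local Notation cl := (cls rel).

Lemma clsD s t : cl (Add s t) = cl s + cl t. Proof. by rewrite -pres_addE. Qed.
Lemma clsM s t : cl (Mul s t) = cl s * cl t. Proof. by rewrite -pres_mulE. Qed.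
Lemma clsN s : cl (Opp s) = - cl s. Proof. by rewrite -pres_oppE. Qed.
Lemma cls_rel s t : rel s t -> cl s = cl t.
Proof. by move=> st; apply/clsP/cong_rel. Qed.

Lemma pres_ind (P : pres rel -> Prop) :
  (forall x, P (cl (Gen x))) -> P 1 -> (forall u v, P u -> P v -> P (u - v)) ->
  (forall u v, P u -> P v -> P (u * v)) -> forall u, P u.
Proof.
move=> Pg P1 PB PM.
have P0 : P 0 by rewrite -(subrr 1); apply: (PB).
have PN u : P u -> P (- u) by move=> Pu; rewrite -sub0r; apply: (PB).
move=> u; rewrite -[u]cls_repr; elim: (repr u) => {u} //.
- by move=> w IH; rewrite clsN; apply: PN.
- by move=> w IHw v IHv; rewrite clsD -[cl v]opprK; apply/PB/PN.
- by move=> w IHw v IHv; rewrite clsM; apply: PM.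
Qed.
End Pres.

Section Concrete.
Variable R : realType.
Local Notation C := (complex R).
Local Notation U := (U R).

Lemma loc_embD (a b : UG R) : loc_emb (@D R) (a + b) = loc_emb (@D R) a + loc_emb (@D R) b.
Proof. by rewrite /loc_emb -clsD; apply/cls_rel; constructor. Qed.
Lemma loc_embM (a b : UG R) : loc_emb (@D R) (a * b) = loc_emb (@D R) a * loc_emb (@D R) b.
Proof. by rewrite /loc_emb -clsM; apply/cls_rel; constructor. Qed.
Lemma loc_emb1 : loc_emb (@D R) 1 = 1.
Proof. by apply/cls_rel; constructor. Qed.
Lemma loc_embB (a b : UG R) : loc_emb (@D R) (a - b) = loc_emb (@D R) a - loc_emb (@D R) b.
Proof. by apply/eqP; rewrite eq_sym subr_eq -loc_embD subrK. Qed.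
HB.instance Definition _ := GRing.isZmodMorphism.Build _ _ (loc_emb (@D R)) loc_embB.
HB.instance Definition _ := GRing.isMonoidMorphism.Build _ _ (loc_emb (@D R)) (loc_emb1, loc_embM).

Lemma U_vecD (x y : G R) : U_vec (x + y) = U_vec x + U_vec y.
Proof. by rewrite /U_vec -loc_embD; congr loc_emb;
  rewrite /env_vec -clsD; apply/cls_rel; constructor. Qed.
Lemma U_vecZ c (x : G R) : U_vec (c *: x) = U_scal c * U_vec x.
Proof. by rewrite /U_vec -loc_embM; congr loc_emb;
  rewrite /env_vec -clsM; apply/cls_rel; constructor. Qed.
Lemma U_vecB (x y : G R) : U_vec (x - y) = U_vec x - U_vec y.
Proof. by apply/eqP; rewrite eq_sym subr_eq -U_vecD subrK. Qed.
HB.instance Definition _ := GRing.isZmodMorphism.Build _ _ (@U_vec R) U_vecB.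

Lemma U_scalD (c d : C) : U_scal (c + d) = U_scal c + U_scal d :> U.
Proof. by rewrite /U_scal -loc_embD; congr loc_emb;
  rewrite /env_scal -clsD; apply/cls_rel; constructor. Qed.
Lemma U_scalM (c d : C) : U_scal (c * d) = U_scal c * U_scal d :> U.
Proof. by rewrite /U_scal -loc_embM; congr loc_emb;
  rewrite /env_scal -clsM; apply/cls_rel; constructor. Qed.
Lemma U_scal1 : U_scal 1 = 1 :> U.
Proof. by rewrite /U_scal -loc_emb1; congr loc_emb; apply/cls_rel; constructor. Qed.
Lemma U_scalB (c d : C) : U_scal (c - d) = U_scal c - U_scal d :> U.
Proof. by apply/eqP; rewrite eq_sym subr_eq -U_scalD subrK. Qed.
HB.instance Definition _ := GRing.isZmodMorphism.Build _ _ (@U_scal R) U_scalB.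
HB.instance Definition _ := GRing.isMonoidMorphism.Build _ _ (@U_scal R) (U_scal1, U_scalM).

Lemma U_scal_vec c (x : G R) : U_scal c * U_vec x = U_vec x * U_scal c.
Proof.
by rewrite /U_scal /U_vec -!loc_embM; congr loc_emb; rewrite -!clsM; apply/cls_rel; constructor.
Qed.

Lemma U_vec_br p q (x y : G R) : G_hom p x -> G_hom q y ->
  U_vec x * U_vec y - (-1) ^+ (p && q) * (U_vec y * U_vec x) = U_vec (G_br x y).
Proof.
move=> hx hy; have : U_scal ((-1) ^+ (p && q)) = (-1) ^+ (p && q) :> U.
  by rewrite rmorphXn rmorphN1.
move=> <-; rewrite /U_scal /U_vec -!loc_embM -loc_embB; congr loc_emb.
by have := cls_rel (env_br (@G_br R) hx hy); rewrite clsD clsN !clsM.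
Qed.

Lemma H_subE (n : int) : loc_emb (@D R) (H_sub R n) = H R - n%:~R.
Proof. by rewrite rmorphB rmorph_int. Qed.

Lemma loc_invr (d : UG R) (Dd : D d) : loc_emb (@D R) d * loc_inv Dd = 1.
Proof. by have := cls_rel (loc_mulV (exist _ _ Dd)); rewrite clsM. Qed.
Lemma loc_invl (d : UG R) (Dd : D d) : loc_inv Dd * loc_emb (@D R) d = 1.
Proof. by have := cls_rel (loc_mulVl (exist _ _ Dd)); rewrite clsM. Qed.

Lemma H_sub_invr (n : int) : (H R - n%:~R) * H_sub_inv R n = 1.
Proof. by rewrite -H_subE loc_invr. Qed.
Lemma H_sub_invl (n : int) : H_sub_inv R n * (H R - n%:~R) = 1.
Proof. by rewrite -H_subE loc_invl. Qed.

(** * The two factors osp(1|2) inside the localized algebra *)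

Lemma osp_brE i j : osp_br (osp_e R i) (osp_e R j) = osp_br_e R i j.
Proof.
rewrite /osp_br (bigD1 i)//= (bigD1 j)//= !ffunE !eqxx mulr1 scale1r.
rewrite [X in _ + X + _]big1 => [|k /negPf kj]; last by rewrite !ffunE kj mulr0 scale0r.
rewrite addr0 big1 ?addr0// => k /negPf ki; apply: big1 => l _.
by rewrite !ffunE ki mul0r scale0r.
Qed.
Lemma osp_br0r u : osp_br u 0 = 0 :> osp R.
Proof. by rewrite /osp_br big1// => i _; rewrite big1// => j _; rewrite ffunE mulr0 scale0r. Qed.
Lemma osp_br0l u : osp_br 0 u = 0 :> osp R.
Proof. by rewrite /osp_br big1// => i _; rewrite big1// => j _; rewrite ffunE mul0r scale0r. Qed.

Lemma osp_hom_e i : osp_hom (osp_odd i) (osp_e R i).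
Proof. by move=> j; rewrite ffunE; case: (j =P i) => // ->; rewrite eqxx. Qed.
Lemma osp_hom0 p : osp_hom p (0 : osp R).
Proof. by move=> j _; rewrite ffunE. Qed.

Definition in_factor (l : bool) (x : osp R) : G R := if l then (x, 0) else (0, x).
Lemma in_factorB l : {morph in_factor l : x y / x - y}.
Proof. by case: l => u v; rewrite /in_factor; apply/pair_equal_spec; rewrite /= subrr. Qed.
HB.instance Definition _ l := GRing.isZmodMorphism.Build _ _ (in_factor l) (in_factorB l).

Lemma in_factorZ l c x : in_factor l (c *: x) = c *: in_factor l x.
Proof. by case: l; rewrite /in_factor; apply/pair_equal_spec; rewrite /= scaler0. Qed.

Definition gen l i : U := U_vec (in_factor l (osp_e R i)).

Lemma gen_br l i j : gen l i * gen l j - (-1) ^+ (osp_odd i && osp_odd j) * (gen l j * gen l i)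
  = U_vec (in_factor l (osp_br_e R i j)).
Proof.
rewrite (@U_vec_br (osp_odd i) (osp_odd j)); first congr U_vec.
- by case: l; rewrite /G_br /= osp_brE osp_br0r.
- by case: l; split=> /=; (exact: osp_hom_e || exact: osp_hom0).
- by case: l; split=> /=; (exact: osp_hom_e || exact: osp_hom0).
Qed.

Lemma gen_br_cross i j :
  gen true i * gen false j - (-1) ^+ (osp_odd i && osp_odd j) * (gen false j * gen true i) = 0.
Proof.
rewrite (@U_vec_br (osp_odd i) (osp_odd j)).
- by rewrite /G_br /= osp_br0r osp_br0l raddf0.
- by split=> /=; [exact: osp_hom_e | exact: osp_hom0].
- by split=> /=; [exact: osp_hom0 | exact: osp_hom_e].
Qed.

Lemma gen_triple l : osp_triple (gen l Xp1) (gen l Xm1) (gen l X0).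
Proof.
split.
- by have := gen_br l Xp1 Xm1; rewrite /= expr1 mulN1r opprK.
- by have := gen_br l X0 Xm1; rewrite /= mul1r => /eqP; rewrite subr_eq addrC => /eqP.
- by have := gen_br l Xp1 X0; rewrite /= mul1r => /eqP; rewrite subr_eq addrC => /eqP.
Qed.

Lemma gen_pair : osp_pair (gen true Xp1) (gen true Xm1) (gen true X0)
                        (gen false Xp1) (gen false Xm1) (gen false X0).
Proof.
have cross i j : osp_odd i && osp_odd j ->
    gen true i * gen false j + gen false j * gen true i = 0.
  by move=> oo; have := gen_br_cross i j; rewrite oo expr1 mulN1r opprK.
by split; [exact: gen_triple | exact: gen_triple | exact: cross..].
Qed.

Lemma U_scal_half : U_scal 2^-1 * 2%:R = 1 :> U.
Proof. by rewrite -(rmorph_nat (@U_scal R)) -rmorphM mulVf ?rmorph1// pnatr_eq0. Qed.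

(** The bracket of an odd vector with itself is twice its square; dividing by 2 in the scalars
    recovers the even root vector. *)
Lemma gen_sqr l i j (c : C) :
  gen l i * gen l i + gen l i * gen l i = U_vec (in_factor l ((c * 2) *: osp_e R j)) ->
  gen l i ^+ 2 = U_scal c * gen l j.
Proof.
rewrite in_factorZ U_vecZ -mulr2n -(mulr_natl (gen l i * gen l i)) => e.
by rewrite -[LHS]mul1r -U_scal_half -mulrA e mulrA -rmorphM mulrCA mulVf ?mulr1// pnatr_eq0.
Qed.

Lemma gen_Xp2 l : gen l Xp2 = - gen l Xp1 ^+ 2.
Proof.
rewrite (@gen_sqr l Xp1 Xp2 (-1)) ?rmorphN1 ?mulN1r ?opprK//.
by have := gen_br l Xp1 Xp1; rewrite /= expr1 mulN1r opprK scaleNr.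
Qed.
Lemma gen_Xm2 l : gen l Xm2 = gen l Xm1 ^+ 2.
Proof.
rewrite (@gen_sqr l Xm1 Xm2 1) ?rmorph1 ?mul1r//.
by have := gen_br l Xm1 Xm1; rewrite /= expr1 mulN1r opprK.
Qed.

Lemma XE i : X R i = gen true i + gen false i.
Proof.
rewrite /gen -raddfD /X; congr U_vec; apply/pair_equal_spec.
by rewrite /= addr0 add0r.
Qed.
Lemma txE i : tx R i = gen true i - gen false i.
Proof.
rewrite /gen -raddfB /tx; congr U_vec; apply/pair_equal_spec.
by rewrite /= subr0 sub0r.
Qed.

Lemma X_triple : osp_triple (X R Xp1) (X R Xm1) (H R).
Proof. by rewrite /H !XE; exact: osp_pair_add gen_pair. Qed.

Lemma X_Xp2 : X R Xp2 = - X R Xp1 ^+ 2.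
Proof.
rewrite !XE !gen_Xp2; apply: (@eq_modulo _ _ _
  (gen true Xp1 * gen false Xp1 + gen false Xp1 * gen true Xp1)).
  by ncring.
exact: osp_pair_aa gen_pair.
Qed.
Lemma X_Xm2 : X R Xm2 = X R Xm1 ^+ 2.
Proof.
rewrite !XE !gen_Xm2; apply: (@eq_modulo _ _ _
  (- (gen true Xm1 * gen false Xm1 + gen false Xm1 * gen true Xm1))).
  by ncring.
by rewrite (osp_pair_bb gen_pair) oppr0.
Qed.

Lemma osp_decomp (x : osp R) : x = \sum_i x i *: osp_e R i.
Proof.
apply/ffunP => j; rewrite sum_ffunE.
have e i : (x i *: osp_e R i) j = if i == j then x j else 0.
  by rewrite !ffunE eq_sym; case: eqP => [->|_]; [exact: mulr1 | exact: mulr0].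
by rewrite (eq_bigr _ (fun i _ => e i)) -big_mkcond big_pred1_eq.
Qed.

(** As a ring, U is generated by the scalars, the four odd root vectors and the inverses of H - n:
    the even basis vectors are squares up to sign, or anticommutators, of odd ones. *)
Lemma U_ind (P : U -> Prop) :
  P 1 -> (forall u v, P u -> P v -> P (u - v)) -> (forall u v, P u -> P v -> P (u * v)) ->
  (forall c, P (U_scal c)) -> (forall l, P (gen l Xp1)) -> (forall l, P (gen l Xm1)) ->
  (forall n, P (H_sub_inv R n)) -> forall u, P u.
Proof.
move=> P1 PB PM Ps Pp Pm Pinv.
have P0 : P 0 by rewrite -(subrr 1); apply: (PB).
have PN u : P u -> P (- u) by move=> Pu; rewrite -sub0r; apply: (PB).
have PD u v : P u -> P v -> P (u + v) by move=> Pu Pv; rewrite -[v]opprK; apply/PB/PN.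
have Py l i : P (gen l i).
  case: i; rewrite ?gen_Xm2 ?gen_Xp2 ?expr2 //; first exact: PM; last by apply/PN/PM.
  by rewrite -(osp_anticomm (gen_triple l)); apply: PD; apply: PM.
have Pl l x : P (U_vec (in_factor l x)).
  rewrite [x]osp_decomp raddf_sum raddf_sum; elim/big_ind: _ => // i _.
  by rewrite /= in_factorZ U_vecZ; apply: PM => //; exact: Py.
have Pvec x : P (U_vec x).
  have -> : x = in_factor true x.1 + in_factor false x.2.
    by case: x => u v; apply/pair_equal_spec; rewrite /= addr0 add0r.
  by rewrite raddfD; apply: PD; exact: Pl.
apply: (@pres_ind _ _ P) => // -[a|[d Dd]].
  change (P (loc_emb (@D R) a)).
  elim/pres_ind: a => [[c|x]||u v Pu Pv|u v Pu Pv].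
  - exact: Ps.
  - exact: Pvec.
  - by rewrite rmorph1.
  - by rewrite rmorphB; apply: PB.
  - by rewrite rmorphM; apply: PM.
(* Stated for any left inverse of [d], so that the induction over the multiplicative set does not
   involve the proof [Dd]; a product is inverted by the inverses in reverse order. *)
have inv w : w * loc_emb (@D R) d = 1 -> P w.
  elim: Dd w => {d} [_ [n ->]||a b Da IHa Db IHb] w wd.
  - by rewrite -[w]mulr1 -(loc_invr (D_H_sub R n)) mulrA wd mul1r; exact: Pinv.
  - by move: wd; rewrite rmorph1 mulr1 => ->.
  - suff -> : w = loc_inv Db * loc_inv Da.
      by apply: PM; [apply: IHb | apply: IHa]; exact: loc_invl.
    have {1}-> : w = w * (loc_emb (@D R) a * (loc_emb (@D R) b * loc_inv Db) * loc_inv Da).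
      by rewrite loc_invr mulr1 loc_invr mulr1.
    by rewrite !mulrA -(mulrA w) -rmorphM wd mul1r.
by apply: inv; exact: loc_invl.
Qed.

Lemma comm_H_sub_inv c n : GRing.comm c (H R) -> GRing.comm c (H_sub_inv R n).
Proof.
move=> cH; apply: comm_inverse (H_sub_invl n) (H_sub_invr n) _.
by apply: commrB => //; exact: commr_int.
Qed.

Lemma U_scal_comm (c : C) (u : U) : GRing.comm u (U_scal c).
Proof.
elim/U_ind: u.
- exact/commr_sym/commr1.
- by move=> u v cu cv; apply/commr_sym/commrB; exact: commr_sym.
- by move=> u v cu cv; apply/commr_sym/commrM; exact: commr_sym.
- by move=> d; rewrite /GRing.comm -!rmorphM mulrC.
- by move=> l; rewrite /GRing.comm U_scal_vec.
- by move=> l; rewrite /GRing.comm U_scal_vec.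
- by move=> n; apply/commr_sym/comm_H_sub_inv; rewrite /GRing.comm U_scal_vec.
Qed.

(** * Centrality of the difference of the two Casimir elements *)

Definition casimir_diff : U := casimir (gen true Xp1) (gen true Xm1) (gen true X0)
   - casimir (gen false Xp1) (gen false Xm1) (gen false X0).

Lemma casimir_diff_central u : GRing.comm u casimir_diff.
Proof.
have [tp tm] := casimir_comm_pair gen_pair.
have [fp fm] := casimir_comm_pair (osp_pair_swap gen_pair).
have yp l : GRing.comm (gen l Xp1) casimir_diff.
  by case: l; apply: commrB => //; exact: casimir_comm_a (gen_triple _).
have ym l : GRing.comm (gen l Xm1) casimir_diff.
  by case: l; apply: commrB => //; exact: casimir_comm_b (gen_triple _).
elim/U_ind: u => //.
- exact/commr_sym/commr1.
- by move=> u v cu cv; apply/commr_sym/commrB; exact: commr_sym.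
- by move=> u v cu cv; apply/commr_sym/commrM; exact: commr_sym.
- by move=> d; apply/commr_sym/U_scal_comm.
(* H is a sum of anticommutators of odd generators, and commuting with H implies commuting with the
   inverses of H - n. *)
- move=> n; apply/commr_sym/comm_H_sub_inv; rewrite /H XE.
  rewrite -!(osp_anticomm (gen_triple _)).
  by repeat (apply: commrD || apply: commrM); apply: commr_sym.
Qed.

(* phi_n(H + e) *)
Fixpoint phi_shift (e : int) (n : nat) : U :=
  if n is m.+1 then
    if odd n then - H_sub_inv R ((uphalf n)%:Z - e) * phi_shift e m
    else U_scal (n./2)%:R^-1 * phi_shift e m
  else 1.

Lemma phi_shiftS e n : phi_shift e n.+1 =
  if odd n.+1 then - H_sub_inv R ((uphalf n.+1)%:Z - e) * phi_shift e n
  else U_scal (n.+1./2)%:R^-1 * phi_shift e n.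
Proof. by []. Qed.

Lemma phiE n : phi R n = phi_shift 0 n.
Proof. by elim: n => //= n ->; rewrite subr0. Qed.

Lemma phi_shift_comm e n c : GRing.comm c (H R) -> GRing.comm c (phi_shift e n).
Proof.
move=> cH; elim: n => [|n IH] /=; first exact: commr1.
case: ifP => _; apply: commrM => //; last exact: U_scal_comm.
by apply/commrN/comm_H_sub_inv.
Qed.

Lemma Xp1_H_sub_inv n : X R Xp1 * H_sub_inv R n = H_sub_inv R (n - 1) * X R Xp1.
Proof.
have shift : (H R - (n - 1)%:~R) * X R Xp1 = X R Xp1 * (H R - n%:~R).
  rewrite mulrBr (osp_ah X_triple) (commr_int (X R Xp1) n) intrB mulr1z.
  by move: (n%:~R : U) => c; ncring.
rewrite -[LHS]mul1r -(H_sub_invl (n - 1)) -mulrA; congr (_ * _).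
by rewrite mulrA shift -mulrA H_sub_invr mulr1.
Qed.

Lemma H_sub_inv_Xm1 n : H_sub_inv R n * X R Xm1 = X R Xm1 * H_sub_inv R (n - 1).
Proof.
have shift : (H R - n%:~R) * X R Xm1 = X R Xm1 * (H R - (n - 1)%:~R).
  rewrite mulrBl (osp_hb X_triple) -(commr_int (X R Xm1) n) intrB mulr1z.
  by move: (n%:~R : U) => c; ncring.
rewrite -[LHS]mulr1 -(H_sub_invr (n - 1)) mulrA; congr (_ * _).
by rewrite -mulrA -shift mulrA H_sub_invl mul1r.
Qed.

Lemma Xp1_phi_shift e n : X R Xp1 * phi_shift e n = phi_shift (e + 1) n * X R Xp1.
Proof.
elim: n => [|n IH] /=; first by rewrite mulr1 mul1r.
case: ifP => _; last by rewrite mulrA U_scal_comm -!mulrA IH.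
by rewrite !mulNr mulrN mulrA Xp1_H_sub_inv -!mulrA IH opprD addrA.
Qed.

Lemma phi_shift_Xm1 e n : phi_shift e n * X R Xm1 = X R Xm1 * phi_shift (e + 1) n.
Proof.
elim: n => [|n IH] /=; first by rewrite mulr1 mul1r.
case: ifP => _; last by rewrite mulrA (U_scal_comm _ (X R Xm1)) -!mulrA IH.
by rewrite !mulNr mulrN -mulrA IH [in LHS]mulrA H_sub_inv_Xm1 -!mulrA opprD addrA.
Qed.

Lemma phi_shift_odd e k : phi_shift e k.*2.+1 * (H R - (k.+1%:Z - e)%:~R) = - phi_shift e k.*2.
Proof.
rewrite phi_shiftS /= odd_double /= doubleK.
have c : GRing.comm (phi_shift e k.*2) (H R - (k.+1%:Z - e)%:~R).
  by apply: commrB; [apply/commr_sym/phi_shift_comm | exact: commr_int].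
by rewrite -mulrA c mulrA mulNr H_sub_invl mulN1r.
Qed.

Lemma phi_shift_even e k : phi_shift e k.+1.*2 *+ k.+1 = phi_shift e k.*2.+1.
Proof.
rewrite doubleS phi_shiftS -doubleS odd_double doubleK.
rewrite -(mulr_natl (_ * _)) mulrA -(rmorph_nat (@U_scal R) k.+1) -rmorphM mulfV ?pnatr_eq0//.
by rewrite rmorph1 mul1r.
Qed.

Lemma phi_proj_coefs : proj_coefs (X R Xp1) (X R Xm1) (H R) (phi_shift 0) (phi_shift 1).
Proof.
split=> //.
- by move=> k; rewrite -phi_shift_odd subr0.
- exact: phi_shift_even.
- by move=> k; rewrite -phi_shift_odd (_ : k.+1%:Z - 1 = k%:Z :> int)// -addn1 PoszD addrK.
- exact: phi_shift_even.
- by move=> n; rewrite Xp1_phi_shift.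
- by move=> n; rewrite phi_shift_Xm1.
Qed.

(** * Local nilpotency of X_+ *)

Lemma X_sqr_gen_p l : X R Xp1 ^+ 2 * gen l Xp1 = gen l Xp1 * X R Xp1 ^+ 2.
Proof.
rewrite XE; case: l; first exact: osp_pair_sqr_a gen_pair.
by rewrite addrC; exact: osp_pair_sqr_a (osp_pair_swap gen_pair).
Qed.
Lemma X_sqr_gen_m l : X R Xp1 ^+ 2 * gen l Xm1 = gen l Xm1 * X R Xp1 ^+ 2 + gen l Xp1.
Proof.
rewrite XE; case: l; first exact: osp_pair_sqr_b gen_pair.
by rewrite addrC; exact: osp_pair_sqr_b (osp_pair_swap gen_pair).
Qed.

(** Quantifying over every [k] makes the property stable under products: if [v] needs M powers of
    X_+, then [u] is asked to let M of them through. *)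
Lemma local_nilpotent u k : exists N w, X R Xp1 ^+ N * u = w * X R Xp1 ^+ k.
Proof.
elim/U_ind: u k.
- by move=> k; exists k, 1; rewrite mulr1 mul1r.
- move=> u v hu hv k; have [N [w e]] := hu k; have [M [x f]] := hv k.
  exists (M + N)%N, (X R Xp1 ^+ M * w - X R Xp1 ^+ N * x).
  by rewrite mulrBr mulrBl -!mulrA -e -f !mulrA -!exprD addnC.
- move=> u v hu hv k; have [M [x f]] := hv k; have [N [w e]] := hu M.
  by exists N, (w * x); rewrite mulrA e -mulrA f mulrA.
- by move=> c k; exists k, (U_scal c); rewrite U_scal_comm.
- move=> l k; exists (2 * k)%N, (gen l Xp1 * X R Xp1 ^+ k).
  by rewrite -mulrA -exprD addnn -mul2n !exprM (commrX k (esym (X_sqr_gen_p l))).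
(* With q = X_+^2, q^(k+1) b = b q^(k+1) + (k+1) a q^k; the exponents split as 2k + 2 = (k+2) + k
   and 2k = k + k. *)
- move=> l k; exists (2 * k.+1)%N, (gen l Xm1 * X R Xp1 ^+ k.+2 + gen l Xp1 * X R Xp1 ^+ k *+ k.+1).
  have e n : (X R Xp1 ^+ 2) ^+ n.+1 * gen l Xm1 =
      gen l Xm1 * (X R Xp1 ^+ 2) ^+ n.+1 + gen l Xp1 * (X R Xp1 ^+ 2) ^+ n *+ n.+1.
    move: (X R Xp1 ^+ 2) (X_sqr_gen_p l) (X_sqr_gen_m l) => q qp qm.
    elim: n => [|n IH]; first by rewrite !expr1 expr0 mulr1 qm.
    rewrite (exprS q n.+1) -mulrA IH mulrDr mulrnAr mulrA qm mulrDl -(mulrA _ q).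
    by rewrite (mulrA q (gen l Xp1)) qp -(mulrA _ q) -(exprS q n) -addrA -mulrS.
  rewrite exprM e mulrDl mulrnAl -!(mulrA (gen _ _)) -!exprD -!exprM !mul2n -!addnn.
  by rewrite (addSnnS k.+1).
- move=> n k; exists k.
  elim: k n => [|k IH] n; first by exists (H_sub_inv R n); rewrite mul1r mulr1.
  have [w e] := IH (n - 1); exists w.
  by rewrite !exprSr -mulrA Xp1_H_sub_inv mulrA e mulrA.
Qed.

(** * The diamond product computed on arbitrary representatives *)

Lemma bar_eq (u v : U) : u - v \in @J R -> bar u = bar v.
Proof. by move=> j; apply/eqP; rewrite -Quotient.idealrBE. Qed.

Lemma barB (u v : U) : bar (u - v) = bar u - bar v.
Proof. exact: (raddfB (\pi_(DRA R))). Qed.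

Lemma J_left (u : U) : X R Xm1 * u \in @J R.
Proof. by apply/asboolP; exists u, 0, 0, 0; rewrite mulr0 !mul0r !addr0. Qed.
Lemma J_right (u : U) : u * X R Xp1 \in @J R.
Proof. by apply/asboolP; exists 0, 0, u, 0; rewrite !mulr0 !mul0r !add0r addr0. Qed.

(** X_(2 alpha) and X_(-2 alpha) are, up to sign, squares of the odd root vectors, so these alone
    generate J. *)
Lemma JP (j : U) : j \in @J R -> exists u v, j = X R Xm1 * u + v * X R Xp1.
Proof.
move=> /asboolP[a [b [c [d ->]]]]; exists (a + X R Xm1 * b), (c - d * X R Xp1).
by rewrite X_Xm2 X_Xp2 !expr2 mulrDr mulrBl mulrN !mulrA.
Qed.

Lemma bar_repr (a : DRA R) : bar (repr a) = a.
Proof. exact: reprK. Qed.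

Lemma repr_bar (u : U) : exists v w, repr (bar u) = u + (X R Xm1 * v + w * X R Xp1).
Proof.
have : repr (bar u) - u \in @J R.
  have /eqP := bar_repr (bar u); rewrite -Quotient.idealrBE; exact.
by move=> /JP[v [w e]]; exists v, w; rewrite -e addrC subrK.
Qed.

Local Notation proj_N := (proj (X R Xp1) (X R Xm1) (phi_shift 0)).

Lemma diamond_big (a b : DRA R) : exists N0, forall N, (N0 <= N)%N ->
  diamond a b = bar (repr a * proj_N N * repr b).
Proof.
have [N0 [w e]] := local_nilpotent (repr b) 1; exists N0 => N leN.
have tail n : (N0 <= n)%N -> exists w', X R Xp1 ^+ n * repr b = w' * X R Xp1.
  by move=> le; exists (X R Xp1 ^+ (n - N0) * w); rewrite -{1}(subnK le) exprD -mulrA e mulrA.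
(* All terms from [N] on vanish in U/J, so the support is finite and the sum does not fall back to
   its default value 0. *)
rewrite /diamond -(fsbig_widen `I_N) //; last first.
  move=> n [_ /= /negP]; rewrite -leqNgt => /(leq_trans leN) /tail[w' e'].
  rewrite -mulrA e' mulrA -[0](subrr (bar (0 : U))) -barB; apply: bar_eq.
  by rewrite subrr subr0 J_right.
rewrite -fsbig_ord /proj mulr_sumr mulr_suml.
have -> : bar (\sum_(i < N) repr a * (phi_shift 0 i * X R Xm1 ^+ i * X R Xp1 ^+ i) * repr b)
   = \sum_(i < N) bar (repr a * (phi_shift 0 i * X R Xm1 ^+ i * X R Xp1 ^+ i) * repr b).
  exact: (raddf_sum (\pi_(DRA R))).
by apply: eq_bigr => i _; rewrite phiE !mulrA.
Qed.

Lemma diamond_bar_l (u : U) (a : DRA R) : exists N0, forall N, (N0 <= N)%N ->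
  diamond (bar u) a = bar (u * proj_N N * repr a).
Proof.
have [N0 h0] := diamond_big (bar u) a.
have [N1 [w1 e1]] := local_nilpotent (repr a) 1.
(* The successor makes the truncation nonempty, as [mula_proj] requires; the bound [N1] puts its
   remainder into J. *)
exists (maxn N0 N1).+1 => -[//|N]; rewrite ltnS geq_max => /andP[le0 le1].
rewrite (h0 N.+1) ?leqW//; apply: bar_eq.
have [v [w ->]] := repr_bar u.
rewrite -!mulrBl addrC addKr !mulrDl -!(mulrA w) (mula_proj X_triple phi_proj_coefs).
rewrite -!(mulrA (X R Xm1)) rpredD ?J_left//.
have -> : X R Xp1 ^+ N.+1 = X R Xp1 ^+ (N.+1 - N1) * X R Xp1 ^+ N1.
  by rewrite -exprD subnK// leqW.
by rewrite -!mulrA e1 !mulrA expr1 J_right.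
Qed.

Lemma diamond_bar_r (u : U) (a : DRA R) : exists N0, forall N, (N0 <= N)%N ->
  diamond a (bar u) = bar (repr a * proj_N N * u).
Proof.
have [N0 h0] := diamond_big a (bar u).
have [v [w e]] := repr_bar u.
(* The remainder of P X_- ends in a power of X_+ that meets [v], so nilpotency is needed on [v]
   here. *)
have [N1 [w1 e1]] := local_nilpotent v 1.
exists (maxn N0 N1).+1 => -[//|N]; rewrite ltnS geq_max => /andP[le0 le1].
rewrite (h0 N.+1) ?leqW//; apply: bar_eq.
rewrite -mulrBr e addrC addKr mulrDr !mulrA rpredD ?J_right//.
rewrite -(mulrA (repr a)) (proj_mulb X_triple phi_proj_coefs).
have -> : X R Xp1 ^+ N = X R Xp1 ^+ (N - N1) * X R Xp1 ^+ N1 by rewrite -exprD subnK.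
by rewrite -!mulrA e1 !mulrA expr1 J_right.
Qed.
End Concrete.

Theorem mainTheorem5 (R : realType) :
  forall a : DRA R, diamond (C1 R) a = diamond a (C1 R).
Proof.
move=> a.
have [N0 h0] := diamond_bar_l ((H R - 1) * tx R X0) a.
have [N1 h1] := diamond_bar_r ((H R - 1) * tx R X0) a.
pose N := maxn N0 N1.
rewrite /C1 (h0 (3 + N)%N) ?(h1 (3 + N)%N); last first.
- by rewrite -(addn0 N0) addnC leq_add// leq_maxl.
- by rewrite -(addn0 N1) addnC leq_add// leq_maxr.
have pc : proj_coefs (gen R true Xp1 + gen R false Xp1) (gen R true Xm1 + gen R false Xm1)
     (gen R true X0 + gen R false X0) (phi_shift R 0) (phi_shift R 1).
  by rewrite -!XE; exact: phi_proj_coefs.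
have Ht : GRing.comm (tx R X0) (H R).
  have [_ _ c] := osp_pair_comm_h (gen_pair R).
  rewrite /H XE txE; apply: (@eq_modulo _ _ _
    ((gen R true X0 * gen R false X0 - gen R false X0 * gen R true X0) *+ 2)).
    by ncring.
  by rewrite c subrr mul0rn.
have c1 n : GRing.comm (phi_shift R 0 n) (gen R true X0 - gen R false X0).
  by rewrite -txE; apply/commr_sym/phi_shift_comm.
have c2 n : GRing.comm (phi_shift R 0 n) (gen R true X0 + gen R false X0).
  by rewrite -XE; apply/commr_sym/phi_shift_comm.
have [w e] := central_proj (gen_pair R) pc c1 c2 N.
have [v f] := proj_central (gen_pair R) pc N.
rewrite -/(casimir_diff R) -!XE -!txE in e f.
apply: bar_eq; rewrite e -(mulrA (repr a)) f.
(* The Casimir terms cancel by centrality, leaving an element of X_- U minus one of U X_+. *)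
rewrite mulrDl mulrDr (casimir_diff_central (repr a)) opprD addrACA subrr add0r.
by rewrite rpredB// ?mulrA ?J_right// -mulrA J_left.
Qed.
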